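(* Let $(M,A,f)$ be a Hom-associative algebra in $\mathcal{LM}$ and let $(V,W,\varphi)$ be a bimodule of $(M,A,f)$. On $M\oplus V$ and $A\oplus W$, with Hom-maps $\alpha_M\oplus\alpha_V$ and $\alpha\oplus\alpha_W$ respectively, define, for $x,x'\in A$, $w,w'\in W$, $m\in M$, $v\in V$, $$\widehat f(m+v)=f(m)+\varphi(v),$$ $$(x+w)(x'+w')=xx'+x\cdot w'+w\cdot x',$$ $$(x+w)\cdot(m+v)=x\cdot m+x\cdot v+w\triangleright m,$$ $$(m+v)\cdot(x+w)=m\cdot x+v\cdot x+m\triangleleft w.$$ Then $(M\oplus V,\,A\oplus W,\,\widehat f)$ is a Hom-associative algebra in $\mathcal{LM}$, called the semidirect product of $(M,A,f)$ and $(V,W,\varphi)$.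
   Context: All vector spaces are over a fixed field of characteristic $0$. A Hom-associative algebra $(A,\alpha)$ is a vector space $A$ with a bilinear multiplication and a linear map $\alpha:A\to A$ with $\alpha(x)(yz)=(xy)\alpha(z)$; Hom-associative algebras are always assumed multiplicative: $\alpha(xy)=\alpha(x)\alpha(y)$. A bimodule of $(A,\alpha)$ is a vector space $M$ with a linear map $\alpha_M:M\to M$ and bilinear left and right actions $x\cdot m$, $m\cdot x\in M$ such that for all $x,y\in A$, $m\in M$: $\alpha_M(x\cdot m)=\alpha(x)\cdot\alpha_M(m)$, $\alpha_M(m\cdot x)=\alpha_M(m)\cdot\alpha(x)$, $\alpha(x)\cdot(y\cdot m)=(xy)\cdot\alpha_M(m)$, $\alpha_M(m)\cdot(xy)=(m\cdot x)\cdot\alpha(y)$, $\alpha(x)\cdot(m\cdot y)=(x\cdot m)\cdot\alpha(y)$. A Hom-associative algebra $(M,A,f)$ in $\mathcal{LM}$ (the Loday-Pirashvili category of linear maps) consists of a Hom-associative algebra $(A,\alpha)$, a bimodule $(M,\alpha_M)$ of it, and a linear map $f:M\to A$ with $\alpha\circ f=f\circ\alpha_M$, $f(x\cdot m)=xf(m)$, $f(m\cdot x)=f(m)x$. A bimodule $(V,W,\varphi)$ of $(M,A,f)$ consists of: bimodules $(V,\alpha_V)$ and $(W,\alpha_W)$ of $(A,\alpha)$; a bimodule map $\varphi:(V,\alpha_V)\to(W,\alpha_W)$, i.e. a linear map with $\varphi\circ\alpha_V=\alpha_W\circ\varphi$, $\varphi(x\cdot v)=x\cdot\varphi(v)$,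 $\varphi(v\cdot x)=\varphi(v)\cdot x$; and linear maps $\triangleright:W\otimes M\to V$, $\triangleleft:M\otimes W\to V$ such that for all $x\in A$, $m\in M$, $w\in W$: $\varphi(w\triangleright m)=w\cdot f(m)$, $\varphi(m\triangleleft w)=f(m)\cdot w$, $\alpha(x)\cdot(w\triangleright m)=(x\cdot w)\triangleright\alpha_M(m)$, $\alpha_W(w)\triangleright(x\cdot m)=(w\cdot x)\triangleright\alpha_M(m)$, $(m\triangleleft w)\cdot\alpha(x)=\alpha_M(m)\triangleleft(w\cdot x)$, $(m\cdot x)\triangleleft\alpha_W(w)=\alpha_M(m)\triangleleft(x\cdot w)$, $\alpha(x)\cdot(m\triangleleft w)=(x\cdot m)\triangleleft\alpha_W(w)$, $\alpha_W(w)\triangleright(m\cdot x)=(w\triangleright m)\cdot\alpha(x)$.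
   Formalization: It is additionally assumed that α_V(w▷m)=α_W(w)▷α_M(m) and α_V(m◁w)=α_M(m)◁α_W(w); the listed bimodule axioms omit this, it is necessary for the conclusion, and the claim fails without it (e.g. A=0, M=V=W=K, φ=0, α_V=0, α_M=α_W=id, w▷m=wm, ◁=0). *)

(* Defs.v *)
From HB Require Import structures.
From mathcomp Require Import all_boot all_algebra.

Set Implicit Arguments.
Unset Strict Implicit.
Unset Printing Implicit Defensive.

Import GRing.Theory.
Local Open Scope ring_scope.

(* Maps are kept as plain functions, and (bi)linearity is part of the           *)
(* predicates below; so asserting a predicate of the semidirect product also    *)
(* asserts that its structure maps are (bi)linear.                              *)

Definition bilinear_map (K : fieldType) (U V W : lmodType K) (b : U -> V -> W)
    : Prop :=
  (forall v, linear (b ^~ v)) /\ (forall u, linear (b u)).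

(* Multiplicativity of [alpha] is part of the definition.                       *)
Record hom_assoc_algebra (K : fieldType) (A : lmodType K)
    (mul : A -> A -> A) (alpha : A -> A) : Prop := HomAssocAlgebra {
  haa_mul_bilinear : bilinear_map mul;
  haa_alpha_linear : linear alpha;
  haa_assoc : forall x y z, mul (alpha x) (mul y z) = mul (mul x y) (alpha z);
  haa_multiplicative : forall x y, alpha (mul x y) = mul (alpha x) (alpha y)
}.

Record hom_bimodule (K : fieldType) (A : lmodType K)
    (mul : A -> A -> A) (alpha : A -> A) (M : lmodType K)
    (lact : A -> M -> M) (ract : M -> A -> M) (alphaM : M -> M) : Prop :=
  HomBimodule {
  hbm_lact_bilinear : bilinear_map lact;
  hbm_ract_bilinear : bilinear_map ract;
  hbm_alphaM_linear : linear alphaM;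
  hbm_alphaM_lact : forall x m, alphaM (lact x m) = lact (alpha x) (alphaM m);
  hbm_alphaM_ract : forall m x, alphaM (ract m x) = ract (alphaM m) (alpha x);
  hbm_lact_mul : forall x y m,
    lact (alpha x) (lact y m) = lact (mul x y) (alphaM m);
  hbm_ract_mul : forall m x y,
    ract (alphaM m) (mul x y) = ract (ract m x) (alpha y);
  hbm_lact_ract : forall x m y,
    lact (alpha x) (ract m y) = ract (lact x m) (alpha y)
}.

(* The underlying data of a Hom-associative algebra (M, A, f) in LM.            *)
Record lm_data (K : fieldType) := LMData {
  lm_alg : lmodType K;
  lm_mod : lmodType K;
  lm_mul : lm_alg -> lm_alg -> lm_alg;
  lm_alpha : lm_alg -> lm_alg;
  lm_lact : lm_alg -> lm_mod -> lm_mod;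
  lm_ract : lm_mod -> lm_alg -> lm_mod;
  lm_alphaM : lm_mod -> lm_mod;
  lm_map : lm_mod -> lm_alg
}.

Record hom_assoc_in_LM (K : fieldType) (L : lm_data K) : Prop :=
  HomAssocInLM {
  hal_alg : hom_assoc_algebra (@lm_mul K L) (@lm_alpha K L);
  hal_bimod : hom_bimodule (@lm_mul K L) (@lm_alpha K L)
                (@lm_lact K L) (@lm_ract K L) (@lm_alphaM K L);
  hal_map_linear : linear (@lm_map K L);
  hal_map_alpha : forall m : lm_mod L,
    lm_alpha (lm_map m) = lm_map (lm_alphaM m);
  hal_map_lact : forall (x : lm_alg L) (m : lm_mod L),
    lm_map (lm_lact x m) = lm_mul x (lm_map m);
  hal_map_ract : forall (m : lm_mod L) (x : lm_alg L),
    lm_map (lm_ract m x) = lm_mul (lm_map m) x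
}.

(* The underlying data of a bimodule (V, W, phi) of (M, A, f); [bm_rtri w m] is *)
(* w |> m and [bm_ltri m w] is m <| w.                                          *)
Record lm_bimod_data (K : fieldType) (L : lm_data K) := LMBimodData {
  bm_V : lmodType K;
  bm_W : lmodType K;
  bm_lactV : lm_alg L -> bm_V -> bm_V;
  bm_ractV : bm_V -> lm_alg L -> bm_V;
  bm_alphaV : bm_V -> bm_V;
  bm_lactW : lm_alg L -> bm_W -> bm_W;
  bm_ractW : bm_W -> lm_alg L -> bm_W;
  bm_alphaW : bm_W -> bm_W;
  bm_phi : bm_V -> bm_W;
  bm_rtri : bm_W -> lm_mod L -> bm_V;
  bm_ltri : lm_mod L -> bm_W -> bm_V
}.

Record bimodule_in_LM (K : fieldType) (L : lm_data K) (B : lm_bimod_data L)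
    : Prop := BimoduleInLM {
  bml_V : hom_bimodule (@lm_mul K L) (@lm_alpha K L)
            (@bm_lactV K L B) (@bm_ractV K L B) (@bm_alphaV K L B);
  bml_W : hom_bimodule (@lm_mul K L) (@lm_alpha K L)
            (@bm_lactW K L B) (@bm_ractW K L B) (@bm_alphaW K L B);
  bml_phi_linear : linear (@bm_phi K L B);
  bml_phi_alpha : forall v : bm_V B,
    bm_phi (bm_alphaV v) = bm_alphaW (bm_phi v);
  bml_phi_lact : forall (x : lm_alg L) (v : bm_V B),
    bm_phi (bm_lactV x v) = bm_lactW x (bm_phi v);
  bml_phi_ract : forall (v : bm_V B) (x : lm_alg L),
    bm_phi (bm_ractV v x) = bm_ractW (bm_phi v) x;
  bml_rtri_bilinear : bilinear_map (@bm_rtri K L B);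
  bml_ltri_bilinear : bilinear_map (@bm_ltri K L B);
  bml_phi_rtri : forall (w : bm_W B) (m : lm_mod L),
    bm_phi (bm_rtri w m) = bm_ractW w (lm_map m);
  bml_phi_ltri : forall (m : lm_mod L) (w : bm_W B),
    bm_phi (bm_ltri m w) = bm_lactW (lm_map m) w;
  bml_lact_rtri : forall (x : lm_alg L) (w : bm_W B) (m : lm_mod L),
    bm_lactV (lm_alpha x) (bm_rtri w m) = bm_rtri (bm_lactW x w) (lm_alphaM m);
  bml_rtri_lact : forall (w : bm_W B) (x : lm_alg L) (m : lm_mod L),
    bm_rtri (bm_alphaW w) (lm_lact x m) = bm_rtri (bm_ractW w x) (lm_alphaM m);
  bml_ltri_ract : forall (m : lm_mod L) (w : bm_W B) (x : lm_alg L),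
    bm_ractV (bm_ltri m w) (lm_alpha x) = bm_ltri (lm_alphaM m) (bm_ractW w x);
  bml_ract_ltri : forall (m : lm_mod L) (x : lm_alg L) (w : bm_W B),
    bm_ltri (lm_ract m x) (bm_alphaW w) = bm_ltri (lm_alphaM m) (bm_lactW x w);
  bml_lact_ltri : forall (x : lm_alg L) (m : lm_mod L) (w : bm_W B),
    bm_lactV (lm_alpha x) (bm_ltri m w) = bm_ltri (lm_lact x m) (bm_alphaW w);
  bml_rtri_ract : forall (w : bm_W B) (m : lm_mod L) (x : lm_alg L),
    bm_rtri (bm_alphaW w) (lm_ract m x) = bm_ractV (bm_rtri w m) (lm_alpha x)
}.

(* The direct sums A (+) W and M (+) V are the product modules, with x + w      *)
(* encoded as (x, w) and m + v as (m, v).                                       *)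
Definition lm_semidirect (K : fieldType) (L : lm_data K) (B : lm_bimod_data L)
    : lm_data K :=
  @LMData K (lm_alg L * bm_W B)%type (lm_mod L * bm_V B)%type
    (fun a b => (lm_mul a.1 b.1, bm_lactW a.1 b.2 + bm_ractW a.2 b.1))
    (fun a => (lm_alpha a.1, bm_alphaW a.2))
    (fun a p => (lm_lact a.1 p.1, bm_lactV a.1 p.2 + bm_rtri a.2 p.1))
    (fun p a => (lm_ract p.1 a.1, bm_ractV p.2 a.1 + bm_ltri p.1 a.2))
    (fun p => (lm_alphaM p.1, bm_alphaV p.2))
    (fun p => (lm_map p.1, bm_phi p.2)).

(* Main.v *)
Require Import Defs.
From mathcomp Require Import all_boot all_algebra.

Import GRing.Theory.
Local Open Scope ring_scope.

(** In each of the three products of the semidirect product, the second summand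
    of a direct sum enters to first order only: [W] times [W], [W] times [V] and
    [V] times [W] are all zero.  So all three have the shape [square_zero_prod] below,
    with multiplication [b] on the first summands and actions [b1], [b2] on the
    second ones, and all Hom-maps act componentwise.

    For products of this shape, an identity that is bilinear or trilinear in its
    arguments splits into one identity for the first summands and one identity
    for each argument that may be taken in the second summand.  All four
    associativity conditions (of the multiplication, of the left action, of the
    right action, and between the two actions) have the form
    [p (a x) (q y z) = r (s x y) (c z)], so [square_zero_assoc] treats them
    together; compatibility with the Hom-maps is [square_zero_morph].  The split
    identities are exactly the axioms on [(M, A, f)] and [(V, W, phi)], together
    with the compatibility of the two triangle maps with the Hom-maps.

    The map [f + phi] splits in the same way: on pairs from [A] and [V] it is
    equivariant because [phi] is a bimodule map, and on pairs from [W] and [M]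
    because [phi] sends the triangle products to the actions of [f m] on [W]. *)

Lemma linear_addr {K : fieldType} {U V : lmodType K} {g : U -> V} :
  linear g -> forall x y, g (x + y) = g x + g y.
Proof. by move=> lin_g x y; have := lin_g 1 x y; rewrite !scale1r. Qed.

Lemma bilinear_map_ext {K : fieldType} {U V W : lmodType K}
    {b c : U -> V -> W} : b =2 c -> bilinear_map c -> bilinear_map b.
Proof.
by move=> bc [cl cr]; split=> u k x y; rewrite /= !bc; [exact: cl | exact: cr].
Qed.

Lemma linear_pair_map {K : fieldType} {U U1 V V1 : lmodType K}
    {g : U -> V} {g1 : U1 -> V1} :
  linear g -> linear g1 ->
  linear ((fun x => (g x.1, g1 x.2)) : U * U1 -> V * V1)%type.
Proof.
by move=> lin_g lin_g1 k x y; congr (_, _); rewrite /= ?lin_g ?lin_g1.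
Qed.

(** For [b] the multiplication of an algebra and [b1], [b2] the actions on a
    bimodule, this is the multiplication of the square-zero extension.  The
    carriers are all independent so that actions have this form as well. *)
Definition square_zero_prod {K : fieldType} {X X1 Y Y1 Z Z1 : lmodType K}
    (b : X -> Y -> Z) (b1 : X -> Y1 -> Z1) (b2 : X1 -> Y -> Z1)
    (x : (X * X1)%type) (y : (Y * Y1)%type) : (Z * Z1)%type :=
  (b x.1 y.1, b1 x.1 y.2 + b2 x.2 y.1).

Lemma square_zero_bilinear {K : fieldType} {X X1 Y Y1 Z Z1 : lmodType K}
    {b : X -> Y -> Z} {b1 : X -> Y1 -> Z1} {b2 : X1 -> Y -> Z1} :
  bilinear_map b -> bilinear_map b1 -> bilinear_map b2 ->
  bilinear_map (square_zero_prod b b1 b2).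
Proof.
move=> [bl br] [b1l b1r] [b2l b2r].
split=> u k x y; congr (_, _); rewrite /= ?bl ?br //.
  by rewrite b1l b2l scalerDr addrACA.
by rewrite b1r b2r scalerDr addrACA.
Qed.

Lemma square_zero_morph {K : fieldType} {X X1 Y Y1 Z Z1 : lmodType K}
    {b : X -> Y -> Z} {b1 : X -> Y1 -> Z1} {b2 : X1 -> Y -> Z1}
    {g : X -> X} {g1 : X1 -> X1} {h : Y -> Y} {h1 : Y1 -> Y1}
    {k : Z -> Z} {k1 : Z1 -> Z1} :
  linear k1 ->
  (forall x y, k (b x y) = b (g x) (h y)) ->
  (forall x y, k1 (b1 x y) = b1 (g x) (h1 y)) ->
  (forall x y, k1 (b2 x y) = b2 (g1 x) (h y)) ->
  let P := square_zero_prod b b1 b2 in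
  forall x y, (k (P x y).1, k1 (P x y).2) = P (g x.1, g1 x.2) (h y.1, h1 y.2).
Proof.
move=> lin_k1 kb kb1 kb2 P x y; congr (_, _) => /=; first exact: kb.
by rewrite (linear_addr lin_k1) kb1 kb2.
Qed.

(** The last three identities are the parts of the conclusion that are linear in
    the second component of [z], of [y] and of [x] respectively. *)
Lemma square_zero_assoc {K : fieldType}
    {X X1 Y Y1 Z Z1 XY XY1 YZ YZ1 T T1 : lmodType K}
    {p : X -> YZ -> T} {p1 : X -> YZ1 -> T1} {p2 : X1 -> YZ -> T1}
    {q : Y -> Z -> YZ} {q1 : Y -> Z1 -> YZ1} {q2 : Y1 -> Z -> YZ1}
    {r : XY -> Z -> T} {r1 : XY -> Z1 -> T1} {r2 : XY1 -> Z -> T1}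
    {s : X -> Y -> XY} {s1 : X -> Y1 -> XY1} {s2 : X1 -> Y -> XY1}
    {a : X -> X} {a1 : X1 -> X1} {c : Z -> Z} {c1 : Z1 -> Z1} :
  bilinear_map p1 -> bilinear_map r2 ->
  (forall x y z, p (a x) (q y z) = r (s x y) (c z)) ->
  (forall x y z, p1 (a x) (q1 y z) = r1 (s x y) (c1 z)) ->
  (forall x y z, p1 (a x) (q2 y z) = r2 (s1 x y) (c z)) ->
  (forall x y z, p2 (a1 x) (q y z) = r2 (s2 x y) (c z)) ->
  forall x y z,
    square_zero_prod p p1 p2 (a x.1, a1 x.2) (square_zero_prod q q1 q2 y z) =
    square_zero_prod r r1 r2 (square_zero_prod s s1 s2 x y) (c z.1, c1 z.2).
Proof.
move=> [_ lin_p1] [lin_r2 _] E Ez Ey Ex x y z.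
congr (_, _) => /=; first exact: E.
by rewrite (linear_addr (lin_p1 _)) (linear_addr (lin_r2 _)) Ez Ey Ex addrA.
Qed.

(* The listed axioms of a bimodule of (M, A, f) do not say that |> and <|       *)
(* commute with the Hom-maps, yet multiplicativity of the Hom-map of the        *)
(* semidirect product is equivalent to it (for V = W = M = K, A = 0, with       *)
(* phi = 0, alphaV = 0, alphaM = alphaW = id and w |> m = w m, the conclusion   *)
(* fails); so it is assumed in [rtri_hom] and [ltri_hom].                       *)
Theorem proposition4p2 (K : fieldType) (char0 : [pchar K] =i pred0)
    (L : lm_data K) (B : lm_bimod_data L)
    (hL : hom_assoc_in_LM L) (hB : bimodule_in_LM B)
    (rtri_hom : forall (w : bm_W B) (m : lm_mod L),
       bm_alphaV (bm_rtri w m) = bm_rtri (bm_alphaW w) (lm_alphaM m))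
    (ltri_hom : forall (m : lm_mod L) (w : bm_W B),
       bm_alphaV (bm_ltri m w) = bm_ltri (lm_alphaM m) (bm_alphaW w)) :
  hom_assoc_in_LM (lm_semidirect B).
Proof.
case: hL => hA hM f_lin f_alpha f_lact f_ract.
case: hB => hV hW phi_lin phi_alpha phi_lact phi_ract rtri_bil ltri_bil.
move=> phi_rtri phi_ltri lact_rtri rtri_lact ltri_ract ract_ltri lact_ltri.
move=> rtri_ract.
case: hA => mul_bil alpha_lin mulA alphaM.
case: hM => lM_bil rM_bil aM_lin aM_l aM_r lM_mul rM_mul lM_r.
case: hV => lV_bil rV_bil aV_lin aV_l aV_r lV_mul rV_mul lV_r.
case: hW => lW_bil rW_bil aW_lin aW_l aW_r lW_mul rW_mul lW_r.
(* The right action lists its two mixed terms in the opposite order. *)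
have ractE (p : lm_mod (lm_semidirect B)) (a : lm_alg (lm_semidirect B)) :
    lm_ract p a = square_zero_prod (@lm_ract K L) (@bm_ltri K L B)
                    (@bm_ractV K L B) p a.
  by congr (_, _); rewrite addrC.
split; [split | split | | | |].
- exact: (square_zero_bilinear mul_bil lW_bil rW_bil).
- exact: (linear_pair_map alpha_lin aW_lin).
- exact: (square_zero_assoc lW_bil rW_bil mulA lW_mul lW_r rW_mul).
- exact: (square_zero_morph aW_lin alphaM aW_l aW_r).
- exact: (square_zero_bilinear lM_bil lV_bil rtri_bil).
- exact: (bilinear_map_ext ractE (square_zero_bilinear rM_bil ltri_bil rV_bil)).
- exact: (linear_pair_map aM_lin aV_lin).
- exact: (square_zero_morph aV_lin aM_l aV_l rtri_hom).
- move=> p a; rewrite !ractE.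
  exact: (square_zero_morph aV_lin aM_r ltri_hom aV_r).
- exact: (square_zero_assoc lV_bil rtri_bil lM_mul lV_mul lact_rtri rtri_lact).
- move=> p a b; rewrite !ractE.
  exact: (square_zero_assoc ltri_bil rV_bil rM_mul
    (fun m x w => esym (ract_ltri m x w)) (fun m w x => esym (ltri_ract m w x))
    rV_mul).
- move=> a p b; rewrite !ractE.
  exact: (square_zero_assoc lV_bil rV_bil lM_r lact_ltri lV_r rtri_ract).
- exact: (linear_pair_map f_lin phi_lin).
- by move=> m; congr (_, _); [exact: f_alpha | exact: esym (phi_alpha _)].
- move=> x m; congr (_, _) => /=; first exact: f_lact.
  by rewrite (linear_addr phi_lin) phi_lact phi_rtri.
- move=> m x; congr (_, _) => /=; first exact: f_ract.
  by rewrite (linear_addr phi_lin) phi_ract phi_ltri addrC.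
Qed.
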